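(* For every integer $k \ge 2$ and every $\varepsilon > 0$ there exist a positive integer $g$ and a $B_{2}[g]$ set $A \subseteq (\mathbb{Z}^{+})^{k}$ such that \[ A(x) \gg x^{\frac{1}{k}-\varepsilon} = x^{\min\{\frac{1}{k},\frac{1}{2}\}-\varepsilon}. \]
   Context: Here $(\mathbb{Z}^{+})^{k} = \{1^{k}, 2^{k}, 3^{k}, \dots\}$ denotes the set of positive perfect $k$-th powers. For a set $A$ of positive integers, $R^{*}_{A,2}(n)$ denotes the number of solutions of $a_{1} + a_{2} = n$ with $a_{1}, a_{2} \in A$ and $a_{1} \le a_{2}$. A set $A$ of positive integers is called a $B_{2}[g]$ set if $R^{*}_{A,2}(n) \le g$ for every positive integer $n$. The counting function is $A(x) = |\{a \in A : a \le x\}|$. The notation $f(x) \ll g(x)$ means $f(x) = O(g(x))$ as $x \to \infty$, and $f \gg g$ means $g \ll f$; the implied constant may depend on $k, \varepsilon$ and $A$. *)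

(* Defs.v *)
From HB Require Import structures.
From mathcomp Require Import all_boot all_order all_algebra finmap.
From mathcomp Require Import boolp classical_sets cardinality reals.
From mathcomp Require Import topology normedtype landau exp.
Set Implicit Arguments.
Unset Strict Implicit.
Unset Printing Implicit Defensive.
Import Order.TTheory GRing.Theory Num.Theory.
Import numFieldNormedType.Exports.
Local Open Scope classical_set_scope.
Local Open Scope ring_scope.

Definition perfect_powers (k : nat) : set nat :=
  [set m | exists2 n : nat, (0 < n)%N & m = (n ^ k)%N].

Definition representations (A : set nat) (n : nat) : set (nat * nat) :=
  [set a | [/\ A a.1, A a.2, (a.1 <= a.2)%N & (a.1 + a.2)%N = n]].

Lemma finite_representations (A : set nat) (n : nat) :
  finite_set (representations A n).
Proof.
apply: (@sub_finite_set _ _ (`I_n.+1 `*` `I_n.+1)); last first.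
  by apply: finite_setX; exact: finite_II.
by case=> a b [_ _ _ /= <-]; split; rewrite /= ltnS ?leq_addr ?leq_addl.
Qed.

(* [fset_set] is the empty set by convention on infinite sets; this does not
   interfere here and in [counting], by the finiteness lemmas. *)
Definition num_representations (A : set nat) (n : nat) : nat :=
  #|` fset_set (representations A n) |.

Definition is_B2 (g : nat) (A : set nat) : Prop :=
  A `<=` [set a | (0 < a)%N] /\
  forall n : nat, (0 < n)%N -> (num_representations A n <= g)%N.

Lemma finite_counting (R : realType) (A : set nat) (x : R) :
  finite_set [set a | A a /\ a%:R <= x].
Proof.
apply: (@sub_finite_set _ _ `I_(Num.truncn x).+1); last exact: finite_II.
by move=> a [_ ax] /=; rewrite -(ltr_nat R); apply: le_lt_trans ax (truncnS_gt _).
Qed.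

Definition counting (R : realType) (A : set nat) (x : R) : nat :=
  #|` fset_set [set a | A a /\ a%:R <= x] |.

(* Main.v *)
(** Write T = 2^j and N = 2^(q j), with 1/q <= k eps. Call b in [N, 2N) an
    n-root if n = a^k + b^k for some 0 < a <= b. The number of n-roots is at
    most tau(n)^2 = n^o(1): for odd k because a + b divides n, and for even k
    because n is then a sum of two squares. Colouring [0, 2N) with T colours at
    random, the probability that some n has more than g roots of one colour is
    at most the number of n, which is polynomial in N, times tau(n)^(2(g+1)) / T^g.
    This is less than 1 for g and j large, so a largest colour class in [N, 2N)
    has at least N / T elements, at most g of which are n-roots, for every n.
    Taking the k-th powers of one such class for every large j gives A: since
    the scales N are sparse, n determines j, and consecutive scales have bounded
    ratio, so A(x) >> x^((1 - 1/q) / k). *)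

Require Import Defs.
From mathcomp Require Import all_boot all_order all_algebra finmap.
From mathcomp Require Import boolp classical_sets cardinality reals.
From mathcomp Require Import topology normedtype landau exp.
From mathcomp Require Import zify ring.
Set Implicit Arguments.
Unset Strict Implicit.
Unset Printing Implicit Defensive.
Import Order.TTheory GRing.Theory Num.Theory.
Import numFieldNormedType.Exports.

(** * The divisor bound *)

Definition ndivisors (n : nat) : nat := size (divisors n).

Lemma ndivisors_gt0 (n : nat) : 0 < ndivisors n.
Proof. by rewrite /ndivisors; case: (divisors n) (divisor1 n). Qed.

(** A divisor [d] of [m * n] is the product of [gcdn d m] and a cofactor that divides [n]. *)
Lemma ndivisorsM (m n : nat) : 0 < m -> 0 < n ->
  ndivisors (m * n) <= ndivisors m * ndivisors n.
Proof.
move=> m0 n0; rewrite /ndivisors -(size_allpairs muln).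
apply: uniq_leq_size (divisors_uniq _) _ => d.
rewrite -dvdn_divisors ?muln_gt0 ?m0 // => dmn.
have g0 : 0 < gcdn d m by rewrite gcdn_gt0 m0 orbT.
have -> : d = gcdn d m * (d %/ gcdn d m) by rewrite mulnC divnK ?dvdn_gcdl.
apply: allpairs_f; rewrite -dvdn_divisors ?dvdn_gcdr //.
rewrite -(dvdn_pmul2r g0) divnK ?dvdn_gcdl // mulnC.
by rewrite muln_gcdl dvdn_gcd dmn dvdn_mulr.
Qed.

Lemma ndivisors_pfactor (p e : nat) : prime p -> ndivisors (p ^ e) <= e.+1.
Proof.
move=> pp; rewrite /ndivisors -(size_iota 0 e.+1) -(size_map (expn p) (iota 0 e.+1)).
apply: uniq_leq_size (divisors_uniq _) _ => d.
rewrite -dvdn_divisors ?expn_gt0 ?prime_gt0 // => /(dvdn_pfactor _ _ pp)[m me ->].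
by apply: map_f; rewrite mem_iota.
Qed.

(** With [a = e %/ D], [e + 1 <= D * (a + 1) <= D * 2 ^ a]; raise this to the power [D]. *)
Lemma expn_succ_le (D e : nat) : 0 < D -> e.+1 ^ D <= D ^ D * 2 ^ e.
Proof.
move=> D0; rewrite {2}(divn_eq e D) expnD expnM mulnA -expnMn.
apply: leq_trans (leq_pmulr _ _); last by rewrite expn_gt0.
rewrite leq_exp2r //; apply: leq_trans (leq_mul (leqnn D) (ltn_expl _ (ltnSn 1))).
by rewrite mulnC {1}(divn_eq e D) mulSn addnC ltn_add2r ltn_mod.
Qed.

(* Only the primes [p < 2 ^ D] can make [(e + 1) ^ D] exceed [p ^ e], and then
   by a factor at most [D ^ D]. *)
Lemma ndivisors_exp_le (D : nat) :
  exists C, forall n, 0 < n -> ndivisors n ^ D <= C * n.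
Proof.
case: D => [|D']; first by exists 1 => n n0; rewrite mul1n.
set D := D'.+1; pose K := D ^ D.
have K0 : 0 < K by rewrite expn_gt0.
exists (K ^ 2 ^ D) => n n0.
have small : \sum_(p < 2 ^ D) (p %| n) <= 2 ^ D.
  by rewrite -[leqRHS]card_ord -sum1_card leq_sum // => i _; case: (_ %| _).
(* The induction carries a sharper exponent of [K], the number of divisors of [n] below [2 ^ D]:
   stripping a small prime from [n] lowers this count, which pays for one factor [K]. *)
apply: leq_trans (leq_mul (leq_pexp2l K0 small) (leqnn n)) => {small}.
elim/ltn_ind: n n0 => n IH n0.
have [->|n1] := eqVneq n 1; first by rewrite /ndivisors exp1n muln1 expn_gt0 K0.
have {n1}pp : prime (pdiv n) by rewrite pdiv_prime // ltn_neqAle eq_sym n1.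
set p := pdiv n in pp; have [m pm nE] := pfactor_coprime pp n0.
set e := logn p n in nE.
have e0 : 0 < e by rewrite logn_gt0 mem_primes pp n0 pdiv_dvd.
have m0 : 0 < m by move: n0; rewrite nE muln_gt0 => /andP[].
have pe0 : 1 < p ^ e by rewrite -(exp1n e) ltn_exp2r ?prime_gt1.
have mn : m < n by rewrite nE -{1}(muln1 m) ltn_pmul2l.
have ndM : ndivisors n ^ D <= ndivisors m ^ D * e.+1 ^ D.
  rewrite -expnMn leq_exp2r // nE.
  apply: leq_trans (ndivisorsM _ _) _ => //; first by rewrite ltnW.
  by rewrite leq_mul2l ndivisors_pfactor // orbT.
apply: leq_trans ndM _; apply: leq_trans (leq_mul (IH m mn m0) (leqnn _)) _.
have dvd_mn (q : 'I_(2 ^ D)) : (q %| m) <= (q %| n).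
  by case qm: (q %| m) => //; rewrite nE dvdn_mulr.
suff: K ^ (\sum_(q < 2 ^ D) (q %| m)) * e.+1 ^ D <=
      K ^ (\sum_(q < 2 ^ D) (q %| n)) * p ^ e.
  move=> H; rewrite [X in _ <= _ * X]nE mulnAC [leqRHS]mulnCA [leqRHS]mulnC.
  by rewrite leq_mul2r H orbT.
have [p_small|p_large] := ltnP p (2 ^ D).
  apply: leq_trans (_ : K ^ (\sum_(q < 2 ^ D) (q %| m)) * (K * p ^ e) <= _).
    rewrite leq_mul2l; apply/orP; right; apply: leq_trans (expn_succ_le _ _) _ => //.
    by rewrite leq_mul2l leq_exp2r // prime_gt1 ?orbT.
  rewrite mulnA -expnSr leq_mul2r; apply/orP; right; apply: leq_pexp2l => //.
  rewrite (bigD1 (Ordinal p_small)) //= [X in _ <= X](bigD1 (Ordinal p_small)) //=.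
  rewrite pdiv_dvd; move: pm; rewrite prime_coprime // => /negbTE ->.
  by rewrite add0n add1n ltnS; apply: leq_sum.
apply: leq_mul; first by apply: leq_pexp2l => //; apply: leq_sum.
apply: leq_trans (_ : 2 ^ (e * D) <= _); last by rewrite mulnC expnM leq_exp2r.
by rewrite expnM leq_exp2r // ltn_expl.
Qed.

(** * Sums of two powers *)

(** Eliminating [y] from the two sums leaves [x * (u * v' - u' * v)], and [x] cancels modulo [d].
    Adding [y * (v * v')] to both terms keeps the truncated subtraction harmless. *)
Lemma dvdn_cross_sub (d x y u v u' v' : nat) : coprime d x ->
  d %| x * u + y * v -> d %| x * u' + y * v' -> d %| u * v' - u' * v.
Proof.
move=> dx duv duv'; rewrite -(Gauss_dvdr _ dx) mulnBr.
rewrite -(subnDr (y * (v * v'))).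
have -> : x * (u * v') + y * (v * v') = (x * u + y * v) * v' by ring.
have -> : x * (u' * v) + y * (v * v') = (x * u' + y * v') * v by ring.
by rewrite dvdn_sub ?dvdn_mulr.
Qed.

Lemma coprime_two_squares_mod4 (x y : nat) : coprime x y -> ~~ (4 %| x ^ 2 + y ^ 2).
Proof.
move=> xy; apply/negP => d4.
have [ex|ox] := boolP (2 %| x); have [ey|oy] := boolP (2 %| y); try lia.
- by have := dvdn_gcd 2 x y; rewrite ex ey (eqP xy).
- case/dvdnP: ex => a xE; move: oy; rewrite dvdn2 negbK => oy.
  have yE := odd_double_half y; rewrite oy -muln2 in yE; nia.
- case/dvdnP: ey => a xE; move: ox; rewrite dvdn2 negbK => oy.
  have yE := odd_double_half x; rewrite oy -muln2 in yE; nia.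
- move: ox oy; rewrite !dvdn2 !negbK => ox oy.
  have xE := odd_double_half x; rewrite ox -muln2 in xE.
  have yE := odd_double_half y; rewrite oy -muln2 in yE; nia.
Qed.

Lemma coprime_two_squares (n x y : nat) :
  coprime x y -> x ^ 2 + y ^ 2 = n -> coprime x n.
Proof.
move=> xy <-; rewrite /coprime expnS expn1 gcdnMDl -/(coprime _ _).
by rewrite coprimeXr.
Qed.

(* With [d] the common gcd and [e = n / d], [e] divides [x v + y u] because [n] divides
   [(x u + y v) (x v + y u)], so [d] and [e] both divide [u v' - u' v]. They are
   coprime, since a common prime factor would be 2 while 4 does not divide [n].
   Hence [n] divides [u v' - u' v], which is smaller than [n] in absolute value. *)
Lemma two_squares_gcd_inj (n x y u v u' v' : nat) :
  0 < x -> 0 < y -> 0 < u -> 0 < v -> 0 < u' -> 0 < v' ->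
  coprime x y -> coprime u v -> coprime u' v' ->
  x ^ 2 + y ^ 2 = n -> u ^ 2 + v ^ 2 = n -> u' ^ 2 + v' ^ 2 = n ->
  gcdn (x * u + y * v) n = gcdn (x * u' + y * v') n -> (u, v) = (u', v').
Proof.
move=> x0 y0 u0 v0 u0' v0' xy uv uv' nxy nuv nuv' dE.
have n0 : 0 < n by rewrite -nxy addn_gt0 expn_gt0 x0.
have cxn := coprime_two_squares xy nxy.
have cyn : coprime y n.
  by apply: (@coprime_two_squares _ _ x); rewrite 1?coprime_sym 1?addnC.
have cvn : coprime v n.
  by apply: (@coprime_two_squares _ _ u); rewrite 1?coprime_sym 1?addnC.
set d := gcdn _ n in dE; pose e := n %/ d.
have nE : n = d * e by rewrite mulnC divnK ?dvdn_gcdr.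
have d0 : 0 < d by rewrite gcdn_gt0 n0 orbT.
have e_dvd a b : a ^ 2 + b ^ 2 = n -> gcdn (x * a + y * b) n = d -> e %| y * a + x * b.
  move=> nab dab.
  have : n %| (x * a + y * b) * (y * a + x * b).
    have -> : (x * a + y * b) * (y * a + x * b)
      = (a ^ 2 + b ^ 2) * (x * y) + (x ^ 2 + y ^ 2) * (a * b) by ring.
    by rewrite nab nxy dvdn_add ?dvdn_mulr.
  have d_ab : d %| x * a + y * b by rewrite -dab dvdn_gcdl.
  (* After cancelling [d], the remaining factor [(x * a + y * b) %/ d] is coprime to [e] because [d]
     is the whole gcd. *)
  rewrite -{1}(divnK d_ab) mulnAC {1}nE [d * e]mulnC dvdn_pmul2r // Gauss_dvdr //.
  rewrite /coprime -(eqn_pmul2r d0) muln_gcdl (divnK d_ab) mul1n.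
  by rewrite [e * d]mulnC -nE gcdnC dab.
have d_uv : d %| x * u + y * v by rewrite dvdn_gcdl.
have d_uv' : d %| x * u' + y * v' by rewrite dE dvdn_gcdl.
have e_uv := e_dvd _ _ nuv erefl; have e_uv' := e_dvd _ _ nuv' (esym dE).
have de : coprime d e.
  apply/negPn/negP => nde; pose p := pdiv (gcdn d e).
  have pp : prime p.
    by rewrite pdiv_prime // ltn_neqAle eq_sym nde gcdn_gt0 d0.
  have [pd pe] : p %| d /\ p %| e.
    by apply/andP; rewrite -dvdn_gcd pdiv_dvd.
  have pn : p %| n by rewrite nE dvdn_mulr.
  have cp z : coprime z n -> p %| z = false.
    move=> zn; apply/negbTE; rewrite -prime_coprime // coprime_sym.
    exact: coprime_dvdr pn zn.
  (* This sum equals [n * u + 2 * x * y * v], so [p] divides [2 * x * y * v], although it divides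
     none of [x], [y], [v]. *)
  have : p %| x * (x * u + y * v) + y * (y * u + x * v).
    by rewrite dvdn_add // dvdn_mull ?(dvdn_trans pd d_uv) ?(dvdn_trans pe e_uv).
  have -> : x * (x * u + y * v) + y * (y * u + x * v)
    = (x ^ 2 + y ^ 2) * u + 2 * x * y * v by ring.
  rewrite nxy (dvdn_addr _ (dvdn_mulr u pn)) !Euclid_dvdM //.
  rewrite (cp x) ?(cp y) ?(cp v) ?orbF // => p2.
  have pE : p = 2 by apply/eqP; rewrite -dvdn_prime2.
  have := coprime_two_squares_mod4 xy; rewrite nxy nE -[4]/(2 * 2) -pE.
  by rewrite dvdn_mul.
(* The truncated difference is a multiple of [n], and [2 * (a * b') <= a ^ 2 + b' ^ 2 < 2 * n] makes
   it zero. Using this in both directions gives [cross]. *)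
have sub0 a b a' b' : 0 < b -> 0 < a' -> a ^ 2 + b ^ 2 = n -> a' ^ 2 + b' ^ 2 = n ->
    d %| x * a + y * b -> d %| x * a' + y * b' ->
    e %| y * a + x * b -> e %| y * a' + x * b' -> a * b' <= a' * b.
  move=> b0 a0 nab nab' dab dab' eab eab'; rewrite -subn_eq0.
  have : n %| a * b' - a' * b.
    rewrite nE Gauss_dvd // (dvdn_cross_sub _ dab dab') ?(dvdn_cross_sub _ eab eab') //.
      by rewrite coprime_sym (coprime_dvdr _ cyn) // nE dvdn_mull.
    by rewrite coprime_sym (coprime_dvdr _ cxn) // nE dvdn_mulr.
  apply: contraLR; rewrite -lt0n => pos; rewrite gtnNdvd //.
  apply: leq_ltn_trans (leq_subr _ _) _; rewrite -(ltn_pmul2l (ltn0Sn 1)).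
  apply: leq_ltn_trans (leq_of_leqif (nat_Cauchy _ _)) _.
  have b2 : 0 < b ^ 2 by rewrite expn_gt0 b0.
  by clear -nab nab' b2; lia.
have cross : u * v' = u' * v by apply/eqP; rewrite eqn_leq !sub0.
have /eqP : u ^ 2 * n = u' ^ 2 * n.
  rewrite -{1}nuv' -nuv !mulnDr [u' ^ 2 * u ^ 2]mulnC; congr (_ + _).
  by rewrite -!expnMn cross.
rewrite eqn_pmul2r // eqn_exp2r // => /eqP uE; rewrite -{}uE in cross *.
by move/eqP: cross; rewrite eqn_pmul2l // => /eqP->.
Qed.

(** The first pair of [s] serves as the reference [(x, y)]; the gcd with [n] then injects [s] into
    the divisors of [n]. *)
Lemma size_coprime_two_squares (n : nat) (s : seq (nat * nat)) : uniq s ->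
  (forall p, p \in s ->
     [/\ 0 < p.1, 0 < p.2, coprime p.1 p.2 & p.1 ^ 2 + p.2 ^ 2 = n]) ->
  size s <= ndivisors n.
Proof.
case: s => [//|[x y] s] us sP; set t := _ :: s in us sP *.
have [/= x0 y0 xy nxy] := sP _ (mem_head _ _).
rewrite -[_.+1]/(size t) -(size_map (fun p => gcdn (x * p.1 + y * p.2) n) t).
apply: uniq_leq_size => [|_ /mapP[p _ ->]]; last first.
  by rewrite -dvdn_divisors ?dvdn_gcdr // -nxy addn_gt0 expn_gt0 x0.
rewrite map_inj_in_uniq // => -[u v] [u' v'] /sP[/= ? ? ? ?] /sP[/= ? ? ? ?].
exact: two_squares_gcd_inj.
Qed.

(** Group the pairs by their gcd [g], a divisor of [n]. Dividing a class by [g] gives coprime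
    representations of [n %/ g ^ 2], whose divisors also divide [n]. *)
Lemma size_two_squares (n : nat) (s : seq (nat * nat)) : uniq s ->
  (forall p, p \in s -> [/\ 0 < p.1, 0 < p.2 & p.1 ^ 2 + p.2 ^ 2 = n]) ->
  size s <= ndivisors n ^ 2.
Proof.
move=> us sP.
have [n0|n0] := posnP n.
  by case: s us sP => // p s _ /(_ _ (mem_head _ _))[]; rewrite n0 => ? ?; nia.
pose cls g := [seq p <- s | gcdn p.1 p.2 == g].
have : {subset s <= flatten [seq cls g | g <- divisors n]}.
  move=> p ps; have [p1 p2 pn] := sP _ ps; apply/flattenP; exists (cls (gcdn p.1 p.2)).
    apply: map_f; rewrite -dvdn_divisors // -pn.
    by rewrite dvdn_add // dvdn_exp // (dvdn_gcdl, dvdn_gcdr).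
  by rewrite mem_filter eqxx.
move/(uniq_leq_size us)/leq_trans; apply.
rewrite size_flatten /shape -map_comp sumnE big_map big_seq.
apply: (@leq_trans (\sum_(g <- divisors n | g \in divisors n) ndivisors n)); last first.
  by rewrite -big_seq big_const_seq count_predT iter_addn_0.
apply: leq_sum => g; rewrite -dvdn_divisors //= => gn; have g0 := dvdn_gt0 n0 gn.
case cE: (cls g) => [//|p0 c']; rewrite -cE.
pose m := n %/ g ^ 2.
have clsP p : p \in cls g ->
    [/\ 0 < p.1, 0 < p.2, gcdn p.1 p.2 = g & p.1 ^ 2 + p.2 ^ 2 = n].
  by rewrite mem_filter => /andP[/eqP ? /sP[]].
have root p : p \in cls g -> p = ((p.1 %/ g) * g, (p.2 %/ g) * g).
  case: p => a b /clsP[/= _ _ <- _]; congr pair; rewrite divnK //.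
    by rewrite dvdn_gcdl.
  by rewrite dvdn_gcdr.
have nE p : p \in cls g -> ((p.1 %/ g) ^ 2 + (p.2 %/ g) ^ 2) * g ^ 2 = n.
  move=> pc; have [_ _ _ <-] := clsP _ pc.
  by rewrite [in RHS](root _ pc) /= !expnMn mulnDl.
have mE : m * g ^ 2 = n.
  have p0c : p0 \in cls g by rewrite cE mem_head.
  by rewrite divnK // -(nE _ p0c) dvdn_mull.
have -> : size (cls g) = size [seq (p.1 %/ g, p.2 %/ g) | p <- cls g].
  by rewrite size_map.
apply: leq_trans (_ : ndivisors m <= _).
  apply: size_coprime_two_squares.
    rewrite map_inj_in_uniq ?filter_uniq // => p q pc qc [e1 e2].
    by rewrite (root _ pc) (root _ qc) e1 e2.
  move=> _ /mapP[p pc ->] /=; have [p1 p2 gE _] := clsP _ pc; split.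
  - by rewrite divn_gt0 // dvdn_leq // -gE dvdn_gcdl.
  - by rewrite divn_gt0 // dvdn_leq // -gE dvdn_gcdr.
  - rewrite /coprime -(eqn_pmul2r g0) muln_gcdl mul1n; apply/eqP.
    by rewrite !divnK // -gE (dvdn_gcdl, dvdn_gcdr).
  - have g20 : 0 < g ^ 2 by rewrite expn_gt0 g0.
    by apply/eqP; rewrite -(eqn_pmul2r g20) nE // mE.
apply: uniq_leq_size (divisors_uniq _) _ => a.
rewrite -!dvdn_divisors //; first by move/dvdn_trans; apply; rewrite -mE dvdn_mulr.
by move: n0; rewrite -mE muln_gt0 => /andP[].
Qed.

Lemma dvdn_add_exp_odd (k a b : nat) : odd k -> a <= b -> a + b %| a ^ k + b ^ k.
Proof.
move=> ok ab; have := odd_double_half k; rewrite ok => <-.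
elim: k./2 => [|l IH]; first by rewrite !expn1.
have -> : a ^ (true + l.+1.*2) + b ^ (true + l.+1.*2)
  = a ^ 2 * (a ^ (true + l.*2) + b ^ (true + l.*2)) + (b ^ 2 - a ^ 2) * b ^ (true + l.*2).
  have sq : a ^ 2 <= b ^ 2 by rewrite leq_sqr.
  rewrite mulnDr mulnBl -!addnA subnKC ?leq_mul2r ?sq ?orbT // doubleS -!expnD.
  by [].
by rewrite dvdn_add ?(dvdn_mull _ IH) // subn_sqr mulnAC dvdn_mull // addnC.
Qed.

(** Convexity of the [k]-th power, written without subtraction. *)
Lemma expn_increment_leq (k a b t : nat) : a <= b ->
  (a + t) ^ k + b ^ k <= a ^ k + (b + t) ^ k.
Proof.
move=> ab; elim: k => [//|k IH]; rewrite !expnS.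
have leA : a ^ k <= (a + t) ^ k by case: k {IH} => // k; rewrite leq_exp2r ?leq_addr.
have leAB : (a + t) ^ k <= (b + t) ^ k.
  by case: k {IH leA} => // k; rewrite leq_exp2r ?leq_add2r.
move: (a ^ k) (b ^ k) ((a + t) ^ k) ((b + t) ^ k) IH leA leAB => A B A' B' IH leA leAB.
by nia.
Qed.

Lemma expn_increment_ltn (k a b t : nat) : 1 < k -> 0 < t -> a < b ->
  (a + t) ^ k + b ^ k < a ^ k + (b + t) ^ k.
Proof.
case: k => [//|k] k0 t0 ab; have := expn_increment_leq k t (ltnW ab); rewrite !expnS.
have leA : a ^ k <= (a + t) ^ k by rewrite leq_exp2r ?leq_addr.
have ltAB : (a + t) ^ k < (b + t) ^ k by rewrite ltn_exp2r ?ltn_add2r.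
move: (a ^ k) (b ^ k) ((a + t) ^ k) ((b + t) ^ k) leA ltAB => A B A' B' leA ltAB IH.
by nia.
Qed.

Lemma size_power_sums (k n : nat) (s : seq (nat * nat)) : 1 < k -> uniq s ->
  (forall p, p \in s -> [/\ 0 < p.1, p.1 <= p.2 & p.1 ^ k + p.2 ^ k = n]) ->
  size s <= ndivisors n ^ 2.
Proof.
move=> k1 us sP; have k0 : 0 < k by rewrite ltnW.
have [ok|ek] := boolP (odd k).
  apply: leq_trans (_ : ndivisors n <= _); last by rewrite leq_pmull ?ndivisors_gt0.
  rewrite -(size_map (fun p => p.1 + p.2) s).
  apply: uniq_leq_size => [|_ /mapP[p ps ->]]; last first.
    have [p0 p12 pn] := sP _ ps; rewrite -dvdn_divisors -pn ?dvdn_add_exp_odd //.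
    by rewrite addn_gt0 expn_gt0 p0.
  rewrite map_inj_in_uniq // => -[a b] [a' b'].
  move=> /sP[/= a0 ab nE] /sP[/= a0' ab' nE'] sumE.
  wlog bb' : a b a' b' a0 ab nE a0' ab' nE' sumE / b <= b'.
    by move=> W; case/orP: (leq_total b b') => bb'; [apply: W|apply/esym; apply: W].
  move: bb'; rewrite leq_eqVlt => /predU1P[bE|bb'].
    by move: sumE; rewrite bE => /addIn->.
  (* Two pairs with equal sum differ by a shift [t = b' - b]; strict convexity makes the wider pair
     have the larger power sum, whereas both equal [n]. *)
  have aE : a = a' + (b' - b) by lia.
  have a'b : a' < b by lia.
  have t0 : 0 < b' - b by rewrite subn_gt0.
  have := expn_increment_ltn k1 t0 a'b.
  by rewrite -aE (subnKC (ltnW bb')) nE nE' ltnn.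
pose l := k./2.
have kE : k = l * 2 by rewrite muln2 -[LHS]odd_double_half (negbTE ek).
have l0 : 0 < l by move: k0; rewrite kE muln_gt0 => /andP[].
rewrite -(size_map (fun p => (p.1 ^ l, p.2 ^ l)) s); apply: size_two_squares.
  rewrite map_inj_in_uniq // => -[a b] [a' b'] _ _ /= [/eqP + /eqP].
  by rewrite !eqn_exp2r // => /eqP -> /eqP ->.
move=> _ /mapP[p /sP[p1 p12 pn] ->] /=.
by rewrite !expn_gt0 p1 (leq_trans p1 p12) -!expnM -kE.
Qed.

(** * Sparse blocks from colourings *)

Lemma bin_leq_exp (n m : nat) : 'C(n, m) <= n ^ m.
Proof.
have ffact_le p : n ^_ p <= n ^ p.
  by elim: p => // p IH; rewrite ffactnSr expnSr leq_mul ?leq_subr.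
by apply: leq_trans (ffact_le m); rewrite -bin_ffact leq_pmulr ?fact_gt0.
Qed.

(** Union bound by counting: a bad colouring is constant on some [g + 1] points of an edge. At most
    [#|I| * #|C| * s ^ g.+1] choices of edge, colour and points arise, each met by
    [#|C| ^ (#|V| - g.+1)] colourings, fewer than [#|C| ^ #|V|] in total. *)
Lemma coloring_few_per_edge (V I C : finType) (E : I -> {set V}) (s g : nat) :
  0 < #|C| -> (forall i, #|E i| <= s) -> #|I| * s ^ g.+1 < #|C| ^ g ->
  exists f : V -> C, forall i c, #|[set v in E i | f v == c]| <= g.
Proof.
move=> C0 Es small.
case: (boolP [exists f : {ffun V -> C}, forall i, forall c,
  #|[set v in E i | f v == c]| <= g]).
  by move=> /existsP[f fP]; exists f => i c; move/forallP/(_ i)/forallP: fP; apply.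
rewrite negb_exists => /forallP bad; exfalso.
pose draws i := [set t : {set V} | t \subset E i & #|t| == g.+1].
(* Taking [c] as the default value, functions supported on the complement of [t] are those equal to
   [c] on [t]. *)
pose mono c (t : {set V}) :=
  [set f : {ffun V -> C} | f \in pffun_on c (mem (~: t)) predT].
have cover (f : {ffun V -> C}) : exists i c t, t \in draws i /\ f \in mono c t.
  move: (bad f); rewrite negb_forall => /existsP[i]; rewrite negb_forall => /existsP[c].
  rewrite -ltnNge -bin_gt0 -cards_draws card_gt0 => /set0Pn[t].
  rewrite inE => /andP[tE tg].
  exists i, c, t; split.
    rewrite inE tg andbT; apply: fintype.subset_trans tE _.
    by apply/fintype.subsetP => v; rewrite inE => /andP[].
  rewrite inE; apply/pffun_onP; split => //; apply/fintype.subsetP => v; rewrite !inE.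
  by apply: contra => /(fintype.subsetP tE); rewrite inE => /andP[].
have total : #|{ffun V -> C}| <=
    \sum_i \sum_(c : C) \sum_(t in draws i) #|mono c t|.
  rewrite -sum1_card.
  apply: leq_trans (_ : \sum_(f : {ffun V -> C}) \sum_i \sum_(c : C)
      \sum_(t in draws i) (f \in mono c t) <= _).
    apply: leq_sum => f _; have [i [c [t [ti fc]]]] := cover f.
    by rewrite (bigD1 i) //= (bigD1 c) //= (bigD1 t) //= fc.
  rewrite exchange_big; apply: leq_sum => i _ /=.
  rewrite exchange_big; apply: leq_sum => c _ /=.
  rewrite exchange_big; apply: leq_sum => t _ /=.
  by rewrite -sum1_card [leqRHS]big_mkcond /=; apply: leq_sum => f _; case: (f \in _).
(* This makes the subtraction [#|V| - g.+1] exact; a bad colouring already exhibits [g + 1]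
   points. *)
have V_large : g < #|V|.
  have [f0] : exists f0 : {ffun V -> C}, true.
    by move/card_gt0P: C0 => [c _]; exists [ffun => c].
  have [i [c [t [+ _]]]] := cover f0.
  by rewrite inE => /andP[_ /eqP<-] _; exact: max_card.
move: total; apply/negP; rewrite -ltnNge card_ffun.
apply: leq_ltn_trans
  (_ : \sum_(i : I) \sum_(c : C) s ^ g.+1 * #|C| ^ (#|V| - g.+1) < _).
  apply: leq_sum => i _; apply: leq_sum => c _.
  apply: leq_trans (_ : \sum_(t in draws i) #|C| ^ (#|V| - g.+1) <= _).
    apply: leq_sum => t; rewrite inE => /andP[_ /eqP tg].
    by rewrite cardsE card_pffun_on -[#|predT|]/#|C| [#|mem _|]cardsCs finset.setCK tg.
  rewrite sum_nat_const leq_mul2r cards_draws; apply/orP; right.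
  by apply: leq_trans (bin_leq_exp _ _) _; rewrite leq_exp2r.
set m := #|V| - g.+1.
have -> : \sum_(i : I) \sum_(c : C) s ^ g.+1 * #|C| ^ m
  = #|C| ^ m.+1 * (#|I| * s ^ g.+1).
  transitivity (#|I| * (#|C| * (s ^ g.+1 * #|C| ^ m))); first by rewrite !sum_nat_const.
  by rewrite (expnS #|C| m) mulnACA [#|C| ^ m * _]mulnC mulnA [#|I| * _]mulnC.
rewrite -(subnK V_large) -/m -addSnnS expnD ltn_pmul2l //.
by rewrite expn_gt0 C0.
Qed.

Lemma large_color_class (V C : finType) (W : {set V}) (f : V -> C) : 0 < #|C| ->
  exists c, #|W| <= #|C| * #|[set v in W | f v == c]|.
Proof.
move=> /card_gt0P[c0 _]; pose F c := #|[set v in W | f v == c]|.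
exists [arg max_(c > c0) F c]; case: arg_maxnP => //= c _ cmax.
rewrite -sum1_card (partition_big f predT) //= -sum_nat_const.
apply: leq_sum => d _; apply: leq_trans (cmax d isT).
by rewrite /F -sum1_card eq_leq //; apply: eq_bigl => v; rewrite inE.
Qed.

Lemma sparse_block (k q : nat) : 1 < k -> 0 < q ->
  exists g j0, forall j, j0 <= j -> exists B : seq nat,
  [/\ uniq B,
      forall m, m \in B -> 2 ^ (q * j) <= m < 2 ^ (q * j).+1,
      2 ^ (q * j) <= 2 ^ j * size B
    & forall n (s : seq (nat * nat)), uniq s ->
      (forall p, p \in s ->
        [/\ 0 < p.1, p.1 <= p.2, p.2 \in B & p.1 ^ k + p.2 ^ k = n]) ->
      size s <= g].
Proof.
move=> k1 q0; have k0 : 0 < k by rewrite ltnW.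
(* For [n < M] this exponent gives [ndivisors n ^ 4 <= 2 ^ (c + j)], so edges have size about the
   square root of the number [2 ^ j] of colours. *)
have [C tauC] := ndivisors_exp_le (q * k * 4).
pose h := q * k + 2; pose c := C + k.+1.
(* The colouring condition compares powers of 2. With [h = q * k + 2] it follows from
   [k + 1 + h * (c + 2) < j], whence the threshold. *)
exists (h * 2).-1, (k + 2 + h * (c + 2)) => j jlarge.
set N := 2 ^ (q * j).
(* [M = 2 * (2 * N) ^ k] exceeds every sum of two [k]-th powers of numbers below [2 * N]. *)
pose M := 2 ^ (k.+1 + q * j * k).
pose P (n : 'I_M) := [set p : 'I_N.*2 * 'I_N.*2 |
  [&& 0 < p.1, p.1 <= p.2 & p.1 ^ k + p.2 ^ k == n]].
pose E n := [set p.2 | p in P n].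
have cardE_tau n : #|E n| <= ndivisors n ^ 2.
  apply: leq_trans (leq_imset_card _ _) _.
  pose v (p : 'I_N.*2 * 'I_N.*2) := (val p.1, val p.2).
  rewrite cardE -(size_map v); apply: (@size_power_sums k) => //.
    rewrite map_inj_uniq ?enum_uniq // => -[a b] [a' b'] [? ?].
    by congr pair; apply: val_inj.
  move=> _ /mapP[p + ->]; rewrite mem_enum inE => /and3P[? ? /eqP ?].
  by split.
pose s := 2 ^ ((c + j)./2.+1).
have cardEs n : #|E n| <= s.
  have [n0|n0] := posnP (val n).
    suff -> : E n = finset.set0 by rewrite cards0.
    apply/setP => v; rewrite inE; apply/imsetP => -[p + _]; rewrite inE n0.
    by rewrite addn_eq0 !expn_eq0 => /and3P[/lt0n_neq0/negbTE->].
  apply: leq_trans (cardE_tau n) _.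
  have qk0 : 0 < q * k by rewrite muln_gt0 q0.
  have : (ndivisors n ^ 2) ^ 2 <= 2 ^ (c + j).
    rewrite -(leq_exp2r _ _ qk0) -!expnM (_ : 2 * (2 * _) = q * k * 4); last by ring.
    apply: leq_trans (tauC _ n0) _.
    apply: leq_trans (leq_mul (ltnW (ltn_expl C (ltnSn 1))) (ltnW (ltn_ord n))) _.
    rewrite -expnD leq_exp2l // /c; nia.
  move/leq_trans => /(_ (s ^ 2)); rewrite leq_exp2r //; apply.
  rewrite -expnM leq_exp2l //; lia.
have T0 : 0 < #|'I_(2 ^ j)| by rewrite card_ord expn_gt0.
have := coloring_few_per_edge (g := (h * 2).-1) T0 cardEs.
rewrite !card_ord prednK ?muln_gt0 ?addn_gt0 ?orbT // -!expnM -expnD ltn_exp2l //.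
case.
  have := odd_double_half (c + j); rewrite -muln2; move: (_./2) => d dE.
  rewrite /h in jlarge *; nia.
move=> f fP; pose W := [set v : 'I_N.*2 | N <= v].
have [col colW] := large_color_class W f T0; rewrite card_ord in colW.
have cardW : N <= #|W|.
  have ltN2 (i : 'I_N) : N + i < N.*2 by rewrite -addnn ltn_add2l.
  pose up i := Ordinal (ltN2 i).
  have up_inj : injective up by move=> i i' /(congr1 val)/addnI/val_inj.
  rewrite -[leqLHS]card_ord -cardsT -(card_imset _ up_inj).
  by apply/subset_leq_card/fintype.subsetP => _ /imsetP[i _ ->]; rewrite inE leq_addr.
pose B := [seq val v | v <- enum [set v in W | f v == col]].
have memB m : m \in B -> exists v : 'I_N.*2, [/\ N <= v, f v = col & m = v].
  by case/mapP => v; rewrite mem_enum !inE => /andP[vN /eqP vc] ->; exists v.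
exists B; split.
- by rewrite map_inj_uniq ?enum_uniq //; apply: val_inj.
- by move=> m /memB[v [vN _ ->]]; rewrite vN /= expnS mul2n.
- by rewrite size_map -cardE (leq_trans cardW).
move=> n t ut tP; case tE: t => [//|p0 t']; rewrite -tE.
have nM : n < M.
  have : p0 \in t by rewrite tE mem_head.
  move=> /tP[a0 ab /memB[v [_ _ vE]] <-]; rewrite vE in ab *.
  apply: (@leq_ltn_trans (v ^ k * 2)).
    by rewrite muln2 -[leqRHS]addnn leq_add2r leq_exp2r.
  rewrite /M expnD expnS expnM -/N mulnC -mulnA ltn_pmul2l // -expnMn mul2n.
  by rewrite ltn_exp2r.
apply: leq_trans (fP (Ordinal nM) col).
rewrite cardE -(size_map val) -(size_map snd t).
(* For fixed [n] the larger root [b] determines the pair, so counting values of [b] suffices. *)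
apply: uniq_leq_size => [|_ /mapP[[a b] abt ->]].
  rewrite map_inj_in_uniq // => -[a b] [a' b'] /tP[_ _ _ /= E1] /tP[_ _ _ /= E2] /= bE.
  by move: E1; rewrite -{}E2 bE => /addIn/eqP; rewrite eqn_exp2r // => /eqP->.
have [/= a0 ab /memB[v [vN vc bE]] nE] := tP _ abt.
rewrite bE; apply/mapP; exists v => //; rewrite mem_enum !inE vc eqxx andbT.
have aN : a < N.*2 by rewrite (leq_ltn_trans ab) // bE.
by apply/imsetP; exists (Ordinal aN, v) => //; rewrite inE /= a0 -bE ab nE eqxx.
Qed.

(** * The set of powers *)

(** For [j < j'] the scale grows by a factor at least 4, so [u ^ k + v ^ k < 2 * (2 * 2 ^ (q * j)) ^
    k <= v' ^ k]. *)
Lemma block_unique (k q j j' u v u' v' : nat) : 1 < k -> 1 < q -> u <= v -> u' <= v' ->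
  2 ^ (q * j) <= v < 2 ^ (q * j).+1 -> 2 ^ (q * j') <= v' < 2 ^ (q * j').+1 ->
  u ^ k + v ^ k = u' ^ k + v' ^ k -> j = j'.
Proof.
move=> k1 q1; wlog jj' : j j' u v u' v' / j < j'.
  move=> W uv uv' vj vj' E; case: (ltngtP j j') => // jj'.
    exact: (W _ _ _ _ _ _ jj' uv uv' vj vj' E).
  exact/esym/(W _ _ _ _ _ _ jj' uv' uv vj' vj)/esym.
move=> uv _ /andP[_ vj] /andP[vj' _] E; have k0 : 0 < k by rewrite ltnW.
suff : u ^ k + v ^ k < v' ^ k by rewrite E ltnNge leq_addl.
apply: (@leq_ltn_trans (2 * v ^ k)); first by rewrite mul2n -addnn leq_add2r leq_exp2r.
apply: leq_trans (_ : (2 ^ (q * j')) ^ k <= _); last by rewrite leq_exp2r.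
apply: (@leq_trans (2 * (2 ^ (q * j).+1) ^ k)).
  by rewrite ltn_pmul2l // ltn_exp2r.
rewrite -!expnM -expnS leq_exp2l //.
apply: (@leq_trans (q * j.+1 * k)); last by rewrite leq_mul2r leq_mul2l jj' !orbT.
rewrite mulSn mulnSr mulnDl -addSn [X in _ <= X]addnC leq_add2r.
by nia.
Qed.

Local Open Scope classical_set_scope.

Definition block_powers (k j0 : nat) (B : nat -> seq nat) : set nat :=
  [set a | exists j m, [/\ j0 <= j, m \in B j & a = m ^ k]].

Lemma sparse_powers (k q : nat) : 1 < k -> 1 < q ->
  exists (g j0 : nat) (B : nat -> seq nat),
    [/\ is_B2 g (block_powers k j0 B), block_powers k j0 B `<=` perfect_powers k
      & forall j, j0 <= j -> [/\ uniq (B j), 2 ^ (q * j) <= 2 ^ j * size (B j)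
          & forall m, m \in B j -> m < 2 ^ (q * j).+1]].
Proof.
move=> k1 q1; have k0 : 0 < k by rewrite ltnW.
have [g [j0 gB]] := sparse_block k1 (ltnW q1).
(* Below [j0] the block is the placeholder [[::]], about which nothing is claimed. *)
have /choice[B BP] : forall j, exists B, j0 <= j -> _ := fun j =>
  match pselect (j0 <= j) with
  | left H => let: ex_intro B P := gB j H in ex_intro _ B (fun=> P)
  | right H => ex_intro _ [::] (fun H' => False_ind _ (H H'))
  end.
exists g, j0, B.
have B_gt0 j m : j0 <= j -> m \in B j -> 0 < m.
  by move=> /BP[_ + _ _] => /[apply] /andP[+ _]; apply: leq_trans; rewrite expn_gt0.
have Apow : block_powers k j0 B `<=` perfect_powers k.
  by move=> a [j [m [jj mB ->]]]; exists m => //; exact: B_gt0 mB.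
split=> //; last by move=> j /BP[uB Bj sB _]; split=> // m /Bj/andP[].
split=> [a /Apow[m m0 ->]|n _]; first by rewrite /= expn_gt0 m0.
pose root a := xget 0 [set m | m ^ k = a].
have rootK m : root (m ^ k) = m.
  rewrite /root; case: xgetP => [r _ /= /eqP|/(_ m)/=]; last by move/(_ erefl).
  by rewrite eqn_exp2r // => /eqP.
pose s : seq (nat * nat) := fset_set (representations (block_powers k j0 B) n).
have sP p : p \in s -> exists j u v, [/\ j0 <= j, 0 < u <= v, v \in B j,
    u ^ k + v ^ k = n & p = (u ^ k, v ^ k)].
  case: p => a b; rewrite in_fset_set; last exact: finite_representations.
  rewrite inE => -[/=[i [u [ii uB ->]]] [j [v [jj vB ->]]]].
  by rewrite leq_exp2r // => uv nE; exists j, u, v; rewrite (B_gt0 i).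
rewrite /num_representations -/s; case sE: s => [//|p0 s']; rewrite -sE.
have : p0 \in s by rewrite sE mem_head.
(* One representation fixes the block [j] of the larger root for all of them. The smaller root may
   lie in any block, which the bound [Bg] allows. *)
case/sP => j [u0 [v0 [jj /andP[_ uv0] vB0 nE0 _]]].
have [_ Bj _ Bg] := BP j jj.
rewrite -(size_map (fun p => (root p.1, root p.2)) s); apply: (Bg n).
  rewrite map_inj_in_uniq ?fset_uniq // => p p' /sP[? [u [v [_ _ _ _ ->]]]].
  by move=> /sP[? [u' [v' [_ _ _ _ ->]]]] /=; rewrite !rootK => -[-> ->].
move=> _ /mapP[p /sP[j' [u [v [jj' /andP[u1 uv] vB nE ->]]]] ->] /=; rewrite !rootK.
split=> //; have [_ Bj' _ _] := BP j' jj'.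
by rewrite (block_unique k1 q1 uv0 uv (Bj _ vB0) (Bj' _ vB)) // nE.
Qed.

(** * Growth of the counting function *)

Lemma size_le_counting (R : realType) (k j0 j N : nat) (B : nat -> seq nat) (x : R) :
  0 < k -> j0 <= j -> uniq (B j) -> (forall m, m \in B j -> m <= N) ->
  ((N ^ k)%:R <= x)%R -> size (B j) <= counting (block_powers k j0 B) x.
Proof.
move=> k0 jj uB BN Nx; rewrite -(size_map (fun m => m ^ k)); apply: uniq_leq_size.
  by rewrite map_inj_uniq // => m m' /eqP; rewrite eqn_exp2r // => /eqP.
move=> _ /mapP[m mB ->]; rewrite in_fset_set; last exact: finite_counting.
rewrite inE; split; first by exists j, m.
by apply: le_trans Nx; rewrite ler_nat leq_exp2r // BN.
Qed.

Local Open Scope ring_scope.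

(** Scales are used with [q.+1] in place of [q]: a block near [2 ^ (q.+1 * j)] has at least
    [2 ^ (q * j)] elements, which is the [k]-th power of the scale raised to [q / (k * q.+1)]. *)
Lemma powR_exp_le (R : realType) (k q j : nat) (e x : R) : (0 < k)%N ->
  e <= q%:R / (k * q.+1)%:R -> 1 <= x -> x <= (2 ^ (k * q.+1 * j))%:R ->
  x `^ e <= (2 ^ (j * q))%:R.
Proof.
move=> k0 eq x1 xj; have kq : 0 < (k * q.+1)%:R :> R by rewrite ltr0n muln_gt0 k0.
apply: le_trans (ler_powR x1 eq) _.
apply: (@le_trans _ _ ((2 ^ (k * q.+1 * j))%:R `^ (q%:R / (k * q.+1)%:R))).
  by apply: ge0_ler_powR; rewrite ?nnegrE ?ler0n ?divr_ge0 ?ler0n // (le_trans ler01).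
rewrite mulnC expnM natrX -powR_mulrn ?ler0n // -powRrM mulrCA divff ?gt_eqF // mulr1.
by rewrite powR_mulrn ?ler0n // -natrX -expnM.
Qed.

Theorem corollary1 (R : realType) (k : nat) (hk : (2 <= k)%N)
    (eps : R) (heps : 0 < eps) :
  exists (g : nat) (A : set nat),
    [/\ (0 < g)%N,
        is_B2 g A,
        A `<=` perfect_powers k,
        (fun x : R => (counting A x)%:R : R)
          \is 'Omega_(pinfty_nbhs R) (fun x : R => x `^ (1 / k%:R - eps))
      & forall x : R, 0 < x ->
          x `^ (1 / k%:R - eps) = x `^ (Num.min (1 / k%:R) (1 / 2) - eps)].
Proof.
have k0 : (0 < k)%N by rewrite ltnW.
have k0R : 0 < k%:R :> R by rewrite ltr0n.
(* This gives [1 / q.+1 <= k * eps], so the exponent [(1 - 1 / q.+1) / k] is at least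
   [1 / k - eps]. *)
pose q := (Num.truncn (k%:R * eps)^-1).+1.
have q0 : (0 < q)%N by [].
have eq : 1 / k%:R - eps <= q%:R / (k * q.+1)%:R.
  have ke : 0 < k%:R * eps by rewrite mulr_gt0.
  have qe : 1 <= k%:R * eps * q.+1%:R.
    rewrite -ler_pdivrMl // mulr1 ltW // (lt_le_trans (truncnS_gt _)) //.
    by rewrite ler_nat.
  rewrite natrM ler_pdivlMr ?mulr_gt0 ?ltr0n // mulrBl mulrA divfK ?gt_eqF //.
  rewrite mul1r mulrA [eps * _]mulrC lerBlDr -natr1.
  by rewrite -natr1 in qe; rewrite lerD2l.
have [g [j0 [B [AB Apow BP]]]] := sparse_powers hk (q0 : 1 < q.+1)%N.
exists g.+1, (block_powers k j0 B); split => //.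
- by case: AB => A0 Ag; split=> // n n0; apply: leqW (Ag n n0).
(* The loss is two scales: block [j] has at least [2 ^ (j * q)] elements, while [x] raised to the
   exponent is at most [2 ^ ((j + 2) * q)]. *)
- apply/asboolP; exists (2 ^ (2 * q))%:R^-1; first by rewrite invr_gt0 ltr0n expn_gt0.
  near=> x.
  have x1 : 1 <= x by near: x; apply: nbhs_pinfty_ge; rewrite num_real.
  have xlarge : (2 ^ (k + k * q.+1 * j0))%:R <= x.
    by near: x; apply: nbhs_pinfty_ge; rewrite num_real.
  rewrite normr_nat ger0_norm ?powR_ge0 // mulrC ler_pdivrMr ?ltr0n ?expn_gt0 //.
  have x0 : 0 <= x by rewrite (le_trans ler01).
  pose L := trunc_log 2 (Num.truncn x).
  have t0 : (0 < Num.truncn x)%N by rewrite truncn_gt0.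
  have /andP[Ll Lu] := trunc_log_bounds (ltnSn 1) t0; rewrite -/L in Ll Lu.
  (* The largest [j] with [(2 ^ (q.+1 * j).+1) ^ k <= 2 ^ L], so that the powers of block [j] stay
     below [x]; the [+ 1] in the exponent accounts for subtracting [k]. *)
  pose j := ((L - k) %/ (k * q.+1))%N.
  have kq0 : (0 < k * q.+1)%N by rewrite muln_gt0 k0.
  have Llarge : (k + k * q.+1 * j0 <= L)%N.
    by rewrite -ltnS -(ltn_exp2l _ _ (ltnSn 1)) (leq_ltn_trans _ Lu) // truncn_ge_nat.
  have jj : (j0 <= j)%N.
    by rewrite leq_divRL // mulnC leq_subRL ?(leq_trans _ Llarge) ?leq_addr.
  have [uB sB mB] := BP j jj.
  apply: (@le_trans _ _ (2 ^ ((j + 2) * q))%:R).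
    apply: (powR_exp_le k0 eq x1).
    apply: ltW; apply: lt_le_trans (truncnS_gt x) _.
    rewrite ler_nat (leq_trans Lu) // leq_exp2l //.
    have := ltn_ceil (L - k) kq0; rewrite -/j mulnC => Lj.
    have kk : (k <= k * q.+1)%N by rewrite leq_pmulr.
    by rewrite addn2 mulnS; lia.
  rewrite mulnDl expnD natrM ler_pM2r ?ltr0n ?expn_gt0 // ler_nat.
  have sizeB : (2 ^ (j * q) <= size (B j))%N.
    by rewrite -(leq_pmul2l (expn_gt0 2 j)) -expnD mulnC -mulSn.
  apply: leq_trans sizeB _.
  apply: (size_le_counting k0 jj uB (fun m mj => ltnW (mB m mj))).
  apply: le_trans (_ : (Num.truncn x)%:R <= x); last by rewrite truncn_le.
  rewrite ler_nat (leq_trans _ Ll) // -expnM leq_exp2l // mulSn.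
  have := leq_divM (L - k) (k * q.+1); rewrite -/j.
  rewrite [(q.+1 * j)%N]mulnC -mulnA [(q.+1 * k)%N]mulnC; lia.
move=> x x0; rewrite min_l // ler_pM2l // lef_pV2 ?posrE ?ltr0n //.
by rewrite ler_nat.
Unshelve. all: by end_near.
Qed.
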